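(* Let $(\{(X^\sigma, d^\sigma)\}_{\sigma \in \Sigma}, \{\alpha^{\sigma}_{\tau} \colon X^\tau\to X^\sigma\}_{\sigma \leqslant \tau})$ be an inverse system, indexed by an upward directed set $\Sigma$, in the category $\mathsf{cmn}$ of compact metric spaces and non-expansive mappings, and assume that $\alpha^\sigma_\tau$ is surjective for all $\sigma \leqslant \tau$. Then this system has an inverse limit in $\mathsf{cmn}$ if and only if there exists an object $Z$ of $\mathsf{cmn}$ together with, for each $\sigma\in\Sigma$, a surjective arrow of $\mathsf{cmn}$ from $Z$ onto $X^\sigma$. Furthermore, if the inverse limit exists, then (1) its object does not depend, up to isometry, on the choice of surjective arrows for the system: if $(\{(X^\sigma, d^\sigma)\}_{\sigma \in \Sigma}, \{\beta^{\sigma}_{\tau}\}_{\sigma \leqslant \tau})$ is another inverse system in $\mathsf{cmn}$ over the same $\Sigma$ with the same objects and with all arrows surjective, then the objects of the inverse limits of the two systems are isometric; (2) the arrows of the inverse limit are surjective.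
   Context: A mapping $f\colon (X,d)\to(Y,\varrho)$ is non-expansive if $\varrho(f(x),f(y))\leqslant d(x,y)$ for all $x,y\in X$. $\mathsf{cmn}$ is the category of all compact metric spaces with non-expansive mappings as arrows. An inverse system in a category $\mathsf A$ indexed by an upward directed set $\Sigma$ is a family of objects $\{A^\sigma\}_{\sigma\in\Sigma}$ with morphisms $\{\alpha_\tau^\sigma\colon A^\tau\to A^\sigma\}_{\sigma\leqslant\tau}$ such that $\alpha_\sigma^\sigma=\mathrm{id}_{A^\sigma}$ and $\alpha_\varrho^\sigma\circ\alpha_\tau^\varrho=\alpha_\tau^\sigma$ for $\sigma\leqslant\varrho\leqslant\tau$. Its inverse limit is an object $A$ of $\mathsf A$ with morphisms $\{\alpha^\sigma\colon A\to A^\sigma\}_{\sigma\in\Sigma}$ such that $\alpha_\tau^\sigma\circ\alpha^\tau=\alpha^\sigma$ for $\sigma\leqslant\tau$, and such that for every object $A'$ and morphisms $\{\xi^\sigma\colon A'\to A^\sigma\}_{\sigma\in\Sigma}$ with $\alpha_\tau^\sigma\circ\xi^\tau=\xi^\sigma$ for $\sigma\leqslant\tau$ there is a unique morphism $\nu\colon A'\to A$ with $\alpha^\sigma\circ\nu=\xi^\sigma$ for all $\sigma\in\Sigma$. *)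

(* Defs.v *)
From HB Require Import structures.
From mathcomp Require Import all_boot all_order all_algebra.
From mathcomp Require Import all_classical all_reals all_analysis.

Set Implicit Arguments.
Unset Strict Implicit.
Unset Printing Implicit Defensive.

Import Order.TTheory GRing.Theory Num.Theory.

Local Open Scope classical_set_scope.
Local Open Scope ring_scope.

Section Category.
Variable R : realType.

(* The empty space is allowed. *)
Record cmn := Cmn {
  cmn_sort :> metricType R;
  cmn_compact : compact [set: cmn_sort]
}.

Definition nonexpansive (X Y : metricType R) (f : X -> Y) : Prop :=
  forall x y, mdist (f x) (f y) <= mdist x y.

Record cmn_hom (X Y : cmn) := CmnHom {
  cmn_fun :> X -> Y;
  cmn_nonexpansive : nonexpansive cmn_fun
}.

(* Leibniz equality of arrows is equality of the underlying maps. *)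
Lemma cmn_hom_eq (X Y : cmn) (f g : cmn_hom X Y) : f =1 g -> f = g.
Proof.
case: f g => [f f1] [g g1] /= /funext fg; rewrite {}fg in f1 *.
by congr CmnHom; exact: Prop_irrelevance.
Qed.

Lemma nonexpansive_id (X : metricType R) : nonexpansive (@id X).
Proof. by move=> x y. Qed.

Lemma nonexpansive_comp (X Y Z : metricType R) (g : Y -> Z) (f : X -> Y) :
  nonexpansive g -> nonexpansive f -> nonexpansive (g \o f).
Proof. by move=> g1 f1 x y; exact: le_trans (g1 _ _) (f1 _ _). Qed.

Definition cmn_id (X : cmn) : cmn_hom X X := CmnHom (@nonexpansive_id X).

Definition cmn_comp (X Y Z : cmn) (g : cmn_hom Y Z) (f : cmn_hom X Y) :
    cmn_hom X Z :=
  CmnHom (nonexpansive_comp (cmn_nonexpansive g) (cmn_nonexpansive f)).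

Definition surjective (X Y : cmn) (f : cmn_hom X Y) : Prop :=
  set_surj [set: X] [set: Y] f.

Definition isometric (X Y : cmn) : Prop :=
  exists f : X -> Y, set_bij [set: X] [set: Y] f /\
    forall x y, mdist (f x) (f y) = mdist x y.

End Category.

(* Antisymmetry and nonemptiness are not required. *)
Definition upward_directed (d : Order.disp_t) (Sigma : preorderType d) : Prop :=
  forall s t : Sigma, exists u : Sigma, (s <= u)%O /\ (t <= u)%O.

Section InverseSystem.
Variables (R : realType) (d : Order.disp_t) (Sigma : preorderType d).

Record inverse_system (X : Sigma -> cmn R) := InverseSystem {
  bond : forall s t : Sigma, (s <= t)%O -> cmn_hom (X t) (X s);
  bond_id : forall (s : Sigma) (ss : (s <= s)%O), bond ss = cmn_id (X s);
  bond_comp : forall (s r t : Sigma)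
    (sr : (s <= r)%O) (rt : (r <= t)%O) (st : (s <= t)%O),
    cmn_comp (bond sr) (bond rt) = bond st
}.

Variables (X : Sigma -> cmn R) (S : inverse_system X).

Definition surjective_system : Prop :=
  forall (s t : Sigma) (st : (s <= t)%O), surjective (bond S st).

Definition is_cone (A : cmn R) (p : forall s, cmn_hom A (X s)) : Prop :=
  forall (s t : Sigma) (st : (s <= t)%O), cmn_comp (bond S st) (p t) = p s.

Definition is_inverse_limit (A : cmn R) (p : forall s, cmn_hom A (X s)) : Prop :=
  is_cone p /\
  forall (A' : cmn R) (xi : forall s, cmn_hom A' (X s)), is_cone xi ->
    exists! nu : cmn_hom A' A, forall s, cmn_comp (p s) nu = xi s.

End InverseSystem.

(* Main.v *)
Require Import Defs.
From HB Require Import structures.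
From mathcomp Require Import all_boot all_order all_algebra.
From mathcomp Require Import all_classical all_reals all_analysis.

(** The proof takes limits along an ultrafilter [U] on [Sigma] that contains
every tail [{t | s <= t}]; directedness makes such a [U] exist as soon as
[Sigma] is inhabited, and in a compact metric space every family indexed by
[Sigma] converges along it ([ultralimit]). A family of points [w t : X t],
compatible or not, then determines a thread of the system, whose coordinate at
[s] is the limit along [U] of the images of [w t] in [X s]
([thread_limit_exists]); this operation does not increase uniform distances
([thread_limit_le]).

Arrows of a limit are surjective: by surjectivity of the bonds, a point [y] of
[X s] lifts to every [X t], and the limit thread of the lifts passes through
[y]. A thread is a cone with vertex a point, so it factors through any limit.
In particular an existing limit maps onto each [X s].

Conversely, let arrows [q s] map [Z] onto each [X s], without any
compatibility. The threads with the supremum of the coordinate distances, which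
is finite since the diameters of the [X s] are bounded by that of [Z], have the
universal property, and only their compactness is in question. Sending [z] to
the limit thread of the points [q t z] is a non-expansive map from [Z] to the
space of threads. It is onto: a thread [x] is the image of the limit along [U]
of any choice of points [z t] with [q t (z t) = x t]. A non-expansive image of
a compact space is compact.

Uniqueness: let [A] and [B] be limits of two systems with the same objects and
arrows [p s] and [q s]. For each [t] choose [g t : A -> B] with
[q t (g t a) = p t a] and put [f a = lim_U g t a]. The distance of [g t a] and
[g t b] is at least that of [p t a] and [p t b], hence, for [s <= t], at least
that of [p s a] and [p s b]; since the distance in [A] is the supremum of the
latter ([inverse_limit_dist_le]), [f] does not decrease distances. There is
such a map from [B] to [A] as well, and a distance non-decreasing self-map of a
compact metric space is a surjective isometry ([expansive_isometry],
[expansive_surjective]), so [f] is an isometry onto [B].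

An empty [Sigma] carries no ultrafilter and is treated apart: the limit is then
a terminal object. *)

Set Implicit Arguments.
Unset Strict Implicit.
Unset Printing Implicit Defensive.

Import Order.TTheory GRing.Theory Num.Theory.

Local Open Scope classical_set_scope.
Local Open Scope ring_scope.

(** * Limits along ultrafilters in compact metric spaces *)

Section Ultralimits.
Variable R : realType.

Lemma ge_eventually (T : Type) (F : set_system T) (FF : ProperFilter F)
    (r c : R) :
  (forall e, 0 < e -> \forall t \near F, r <= c + e) -> r <= c.
Proof.
by move=> rc; apply/ler_addgt0Pr => e e0; have [_] := filter_ex (rc e e0).
Qed.

Lemma eq_eventually (M : metricType R) (T : Type) (F : set_system T)
    (FF : ProperFilter F) (x y : M) :
  (forall e, 0 < e -> \forall t \near F, mdist x y <= e) -> x = y.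
Proof.
move=> xy; apply/mdist_positivity/eqP; rewrite eq_le mdist_ge0 andbT.
by apply: (ge_eventually FF) => e /xy; rewrite add0r.
Qed.

(** A cluster point of [u] along [U] is a limit: of two complementary sets one
belongs to the ultrafilter, and the set of indices at which [u] stays away from
the cluster point cannot. *)
Lemma ultralimit (K : cmn R) (T : Type) (U : set_system T)
    (UU : UltraFilter U) (u : T -> K) :
  exists l, forall e, 0 < e -> \forall t \near U, mdist l (u t) < e.
Proof.
have [l [_ ul]] : [set: K] `&` cluster (u @ U) !=set0.
  by apply: (@cmn_compact R K); exact: filterT.
exists l => e e0.
have [//|far] := in_ultra_setVsetC [set t | mdist l (u t) < e] UU.
have /= [] := ul [set y | ~ mdist l y < e] [set y | mdist l y < e] far.
  by have := nbhsx_ballx l e e0; rewrite ballEmdist.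
by move=> y [].
Qed.

Lemma ultrafilter_nat : exists U : set_system nat,
  UltraFilter U /\ forall n, \forall m \near U, (n <= m)%N.
Proof.
have [U [UU oU]] := ultraFilterLemma eventually_filter.
by exists U; split => // n; apply: oU; exact: nbhs_infty_ge.
Qed.

Lemma ultrafilter_directed d (I : preorderType d) (i0 : I) :
  upward_directed I -> exists U : set_system I,
  UltraFilter U /\ forall i, \forall j \near U, (i <= j)%O.
Proof.
move=> dir; pose tail (i : I) := [set j | (i <= j)%O].
have tails_proper : ProperFilter (filter_from [set: I] tail).
  apply: filter_from_proper => [|i _]; last by exists i; rewrite /tail /=.
  apply: filter_from_filter => [|i j _ _]; first by exists i0.
  have [k [ik jk]] := dir i j; exists k => // l /= kl.
  by split; [exact: le_trans kl|exact: le_trans kl].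
have [U [UU tU]] := ultraFilterLemma tails_proper.
by exists U; split => // i; apply: tU; exists i.
Qed.

(** If there were points [x n], [y n] at distance more than [n], the distance of
their limits along an ultrafilter would exceed every integer. *)
Lemma cmn_bounded (K : cmn R) : exists M : R, forall x y : K, mdist x y <= M.
Proof.
apply: contrapT => /forallNP unbounded.
have /choice[xy far] (n : nat) : exists xy : K * K, n%:R < mdist xy.1 xy.2.
  have /existsNP[x /existsNP[y /negP]] := unbounded n%:R.
  by rewrite -ltNge; exists (x, y).
have [U [UU tailU]] := ultrafilter_nat.
have [a aU] := ultralimit UU (fun n => (xy n).1).
have [b bU] := ultralimit UU (fun n => (xy n).2).
pose M := 1 + mdist a b + 1.
have [n [[an bn] Mn]] := filter_ex (filterI
  (filterI (aU _ ltr01) (bU _ ltr01)) (tailU (Num.bound M))).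
have : mdist (xy n).1 (xy n).2 < M.
  apply: le_lt_trans (metric_triangle _ b _) _; rewrite ltrD//.
  apply: le_lt_trans (metric_triangle _ a _) _; rewrite ltrD2r.
  by rewrite metric_sym.
apply/negP; rewrite -leNgt; apply/ltW/(le_lt_trans _ (far n)).
have M0 : 0 <= M by rewrite !addr_ge0// mdist_ge0.
by apply: le_trans (ltW (archi_boundP M0)) _; rewrite ler_nat.
Qed.

End Ultralimits.

(** * Expansive maps of compact metric spaces *)

Section Expansive.
Variable R : realType.

(** Expansive in the weak sense, so that isometries are included. *)
Definition expansive (A B : cmn R) (f : A -> B) : Prop :=
  forall x y, mdist x y <= mdist (f x) (f y).

Lemma expansive_comp (A B C : cmn R) (g : B -> C) (f : A -> B) :
  expansive g -> expansive f -> expansive (g \o f).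
Proof. by move=> g1 f1 x y; exact: le_trans (f1 _ _) (g1 _ _). Qed.

Lemma expansive_iter (K : cmn R) (f : K -> K) n :
  expansive f -> expansive (iter n f).
Proof.
by move=> f1; elim: n => [|n IHn] x y //=; exact: le_trans (IHn x y) (f1 _ _).
Qed.

(** By compactness two iterates of order [m < n] are close to each other, for
both points at once; as [iter m f] is expansive, they can be pulled back by [m]
steps to the starting points. *)
Lemma expansive_recurrent (K : cmn R) (f : K -> K) (x y : K) (e : R) :
  expansive f -> 0 < e ->
  exists n, mdist x (iter n.+1 f x) < e /\ mdist y (iter n.+1 f y) < e.
Proof.
move=> f1 e0; have [U [UU tailU]] := ultrafilter_nat.
have e20 : 0 < e / 2 by rewrite divr_gt0.
have [a /(_ _ e20) xa] := ultralimit UU (fun n => iter n f x).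
have [b /(_ _ e20) yb] := ultralimit UU (fun n => iter n f y).
have close (c u v : K) : mdist c u < e / 2 -> mdist c v < e / 2 ->
    mdist u v < e.
  move=> cu cv; apply: le_lt_trans (metric_triangle u c v) _.
  by rewrite (metric_sym u) [ltRHS]splitr ltrD.
have [m [xm ym]] := filter_ex (filterI xa yb).
have [n [[xn yn] mn]] := filter_ex (filterI (filterI xa yb) (tailU m.+1)).
have back z : mdist z (iter (n - m.+1).+1 f z) <=
    mdist (iter m f z) (iter n f z).
  have -> : iter n f z = iter m f (iter (n - m.+1).+1 f z).
    by rewrite -iterD addnS -addSn subnKC.
  exact: expansive_iter.
exists (n - m.+1)%N; split; apply: le_lt_trans (back _) _;
  [exact: close xm xn|exact: close ym yn].
Qed.

(** Distances grow along the orbit of a pair, yet recurrence brings the pair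
back near its initial position, so the first step cannot increase them. *)
Lemma expansive_isometry (K : cmn R) (f : K -> K) :
  expansive f -> forall x y, mdist (f x) (f y) = mdist x y.
Proof.
move=> f1 x y; apply/eqP; rewrite eq_le f1 andbT.
apply/ler_addgt0Pr => e e0; have e20 : 0 < e / 2 by rewrite divr_gt0.
have [n [xn yn]] := expansive_recurrent x y f1 e20.
have grow : mdist (f x) (f y) <= mdist (iter n.+1 f x) (iter n.+1 f y).
  by rewrite !iterSr; exact: expansive_iter.
apply: le_trans grow _; apply: le_trans (metric_triangle _ x _) _.
rewrite (metric_sym _ x) [e]splitr addrCA lerD ?(ltW xn)//.
by apply: le_trans (metric_triangle _ y _) _; rewrite lerD2l ltW.
Qed.

(** By recurrence [y] is a limit of values [f z]; a limit of the points [z] is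
mapped to [y], since [f] is continuous, being an isometry. *)
Lemma expansive_surjective (K : cmn R) (f : K -> K) :
  expansive f -> forall y, exists x, f x = y.
Proof.
move=> f1 y.
have /choice[z yz] (n : nat) : exists z, mdist y (f z) < n.+1%:R^-1.
  have n0 : (0 : R) < n.+1%:R^-1 by rewrite invr_gt0.
  by have [k [yk _]] := expansive_recurrent y y f1 n0; exists (iter k f y).
have [U [UU tailU]] := ultrafilter_nat.
have [x zx] := ultralimit UU z.
exists x; apply/esym/(eq_eventually (F := U) _) => e e0.
have e20 : 0 < e / 2 by rewrite divr_gt0.
have [N /ltW Ne] : exists N : nat, N.+1%:R^-1 < e / 2.
  have [N _ /(_ N (leqnn N)) Ne] := near_infty_natSinv_lt (PosNum e20).
  by exists N.
near=> n; have xn : mdist x (z n) < e / 2 by near: n; exact: zx.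
have Nn : (N <= n)%N by near: n; exact: tailU.
apply: le_trans (metric_triangle _ (f (z n)) _) _.
rewrite [leRHS]splitr lerD//.
  apply: le_trans (ltW (yz n)) (le_trans _ Ne).
  by rewrite lef_pV2 ?posrE// ler_nat.
by rewrite (expansive_isometry f1) metric_sym ltW.
Unshelve. all: by end_near. Qed.

(** Both [g \o f] and [f \o g] are expansive self-maps: the first, being an
isometry, forces [f] to be one, and the second makes [f] surjective. *)
Lemma expansive_pair_isometric (A B : cmn R) (f : A -> B) (g : B -> A) :
  expansive f -> expansive g -> isometric A B.
Proof.
move=> f1 g1.
have gf1 := expansive_comp g1 f1; have fg1 := expansive_comp f1 g1.
have f_iso x y : mdist (f x) (f y) = mdist x y.
  apply/eqP; rewrite eq_le f1 andbT -(expansive_isometry gf1); exact: g1.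
exists f; split => //; split=> //.
- move=> x y _ _ fxy; apply: mdist_positivity.
  by rewrite -f_iso fxy mdistxx.
- by move=> y _; have [x <-] := expansive_surjective fg1 y; exists (g x).
Qed.

End Expansive.

(** * Compact metric spaces given by a distance function *)

Section CompactFromDistance.
Variable R : realType.

Record is_distance (T : Type) (D : T -> T -> R) : Prop := IsDistance {
  distxx : forall x, D x x = 0;
  dist_separated : forall x y, D x y = 0 -> x = y;
  dist_sym : forall x y, D x y = D y x;
  dist_triangle : forall y x z, D x z <= D x y + D y z
}.

(** A copy of [T] that remembers [DD], so that the metric structure below can be
inferred from the type. *)
Definition distance_space (T : Type) (D : T -> T -> R) (DD : is_distance D) :
  Type := T.

Section Instances.
Variables (T : Type) (D : T -> T -> R) (DD : is_distance D).
Local Notation M := (distance_space DD).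

HB.instance Definition _ := gen_eqMixin M.
HB.instance Definition _ := gen_choiceMixin M.
HB.instance Definition _ := @isMetric.Build R M D (distxx DD)
  (dist_separated DD) (dist_sym DD) (dist_triangle DD).

Lemma distance_space_compact :
  (forall U : set_system T, UltraFilter U ->
    exists l, forall e, 0 < e -> \forall t \near U, D l t < e) ->
  compact [set: M].
Proof.
move=> ulim; rewrite compact_ultra => U UU _.
have [l Ul] := ulim U UU; exists l; split=> //.
by apply/metricType_numDomainType.fcvgrPdist_lt.
Qed.

End Instances.

(** Arrows from such a [P] are points: they detect elements of an object by its
universal property alone. *)
Lemma point_exists : exists P : cmn R, exists a : P, forall x, x = a.
Proof.
have D0 : is_distance (fun _ _ : unit => 0 : R).
  by split=> // -[] [].
have cpt : compact [set: distance_space D0].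
  apply: distance_space_compact => U UU; exists tt => e e0.
  by apply: filterE => t.
by exists (Cmn cpt), tt; case.
Qed.

(** The limit in [Z] of preimages of the points is mapped to a limit of the
points. *)
Lemma image_compact (Z : cmn R) (T : Type) (D : T -> T -> R)
    (DD : is_distance D) (phi : Z -> T) :
  (forall t, exists z, phi z = t) ->
  (forall z z', D (phi z) (phi z') <= mdist z z') ->
  compact [set: distance_space DD].
Proof.
move=> /choice[sec phiK] phi1; apply: distance_space_compact => U UU.
have [z Uz] := ultralimit UU sec.
exists (phi z) => e /Uz; apply: filterS => t; apply: le_lt_trans.
by rewrite -{1}[t]phiK.
Qed.

End CompactFromDistance.

(** * Threads of an inverse system *)

Lemma cmn_comp_apply (R : realType) (A B C : cmn R) (g : cmn_hom B C)
    (f : cmn_hom A B) (h : cmn_hom A C) :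
  cmn_comp g f = h -> forall x, g (f x) = h x.
Proof. by move=> <-. Qed.

Section Threads.
Variables (R : realType) (d : Order.disp_t) (Sigma : preorderType d).
Variables (X : Sigma -> cmn R) (S : inverse_system X).

Definition thread (x : forall s, X s) : Prop :=
  forall s t (st : (s <= t)%O), bond S st (x t) = x s.

Lemma bond_compE s r t (sr : (s <= r)%O) (rt : (r <= t)%O) (st : (s <= t)%O) y :
  bond S sr (bond S rt y) = bond S st y.
Proof. exact: cmn_comp_apply (bond_comp S sr rt st) y. Qed.

Lemma cone_thread (A : cmn R) (p : forall s, cmn_hom A (X s)) a :
  is_cone S p -> thread (fun s => p s a).
Proof. by move=> pS s t st; exact: cmn_comp_apply. Qed.

Lemma thread_cone (A : cmn R) (p : forall s, cmn_hom A (X s)) :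
  (forall a, thread (fun s => p s a)) -> is_cone S p.
Proof. by move=> pS s t st; apply: cmn_hom_eq => a; exact: pS. Qed.

Section UltralimitThread.
Variables (U : set_system Sigma) (UU : UltraFilter U).
Hypothesis tailU : forall s, \forall t \near U, (s <= t)%O.

(** [x s] is the limit along [U] of the image of [w t] in [X s]. That image
exists only for [s <= t], which holds eventually along [U]. *)
Definition thread_limit (w x : forall s, X s) : Prop :=
  forall s e, 0 < e -> \forall t \near U,
    forall st : (s <= t)%O, mdist (x s) (bond S st (w t)) < e.

(** The limits exist by compactness, and they form a thread because bonds are
continuous. *)
Lemma thread_limit_exists w : exists2 x, thread x & thread_limit w x.
Proof.
have limit_at s : exists l : X s, forall e, 0 < e -> \forall t \near U,
    forall st : (s <= t)%O, mdist l (bond S st (w t)) < e.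
  (* At the indices [t] not above [s] the value is irrelevant: [w s] is at
     hand. *)
  have /choice[u uE] (t : Sigma) :
      exists y : X s, forall st : (s <= t)%O, y = bond S st (w t).
    have [st|Nst] := pselect (s <= t)%O; last by exists (w s) => st.
    by exists (bond S st (w t)) => st'; rewrite (bool_irrelevance st' st).
  have [l ul] := ultralimit UU u; exists l => e /ul.
  by apply: filterS => t lt st; rewrite -uE.
have /all_sig[x xlim] s := cid (limit_at s).
exists x => // s r sr; apply: (eq_eventually (F := U) _) => e e0.
have e20 : 0 < e / 2 by rewrite divr_gt0.
near=> t; have rt : (r <= t)%O by near: t; exact: tailU.
have st : (s <= t)%O by exact: le_trans rt.
apply: le_trans (metric_triangle _ (bond S sr (bond S rt (w t))) _) _.
rewrite [leRHS]splitr lerD//.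
  apply: le_trans (cmn_nonexpansive _ _ _) (ltW _).
  by move: rt {st}; near: t; exact: xlim.
rewrite (bond_compE _ _ st) metric_sym ltW//.
by move: st; near: t; exact: xlim.
Unshelve. all: by end_near. Qed.

Lemma thread_limit_self x : thread x -> thread_limit x x.
Proof.
by move=> xS s e e0; apply: filterE => t st; rewrite xS mdistxx.
Qed.

Lemma thread_limit_le w w' x x' c : thread_limit w x -> thread_limit w' x' ->
  (\forall t \near U, mdist (w t) (w' t) <= c) ->
  forall s, mdist (x s) (x' s) <= c.
Proof.
move=> xlim x'lim ww' s; apply: (ge_eventually (F := U) _) => e e0.
have e20 : 0 < e / 2 by rewrite divr_gt0.
near=> t; have st : (s <= t)%O by near: t; exact: tailU.
have xt : mdist (x s) (bond S st (w t)) < e / 2.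
  by move: st; near: t; exact: xlim.
have x't : mdist (x' s) (bond S st (w' t)) < e / 2.
  by move: (st); near: t; exact: x'lim.
have wt : mdist (w t) (w' t) <= c by near: t.
apply: le_trans (metric_triangle _ (bond S st (w t)) _) _.
rewrite [e]splitr addrCA lerD ?(ltW xt)//.
apply: le_trans (metric_triangle _ (bond S st (w' t)) _) _.
rewrite lerD//; first exact: le_trans (cmn_nonexpansive _ _ _) wt.
by rewrite metric_sym ltW.
Unshelve. all: by end_near. Qed.

Lemma thread_limit_value w x s (y : X s) : thread_limit w x ->
  (forall t (st : (s <= t)%O), bond S st (w t) = y) -> x s = y.
Proof.
move=> xlim wy; apply: (eq_eventually (F := U) _) => e e0.
near=> t; have st : (s <= t)%O by near: t; exact: tailU.
rewrite -(wy t st) ltW//.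
by move: st; near: t; exact: xlim.
Unshelve. all: by end_near. Qed.

End UltralimitThread.

Hypothesis Sigma_directed : upward_directed Sigma.

(** The limit thread of any family of points lying over [y] has coordinate [y]
at [s], as it does so already along the tail above [s]. *)
Lemma thread_through (S_surjective : surjective_system S) s (y : X s) :
  exists2 x, thread x & x s = y.
Proof.
(* For [t] not above [s] this only asks for a point of [X t]; an upper bound
   of [s] and [t] provides one, and covers the other case too. *)
have lift t : exists z : X t, forall st : (s <= t)%O, bond S st z = y.
  have [u [su tu]] := Sigma_directed s t.
  have [z _ zy] := S_surjective s u su y I.
  by exists (bond S tu z) => st; rewrite (bond_compE _ _ su).
have /all_sig[w wy] t := cid (lift t).
have [U [UU tailU]] := ultrafilter_directed s Sigma_directed.
have [x xS xlim] := thread_limit_exists UU tailU w.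
by exists x => //; apply: (thread_limit_value UU tailU xlim).
Qed.

(** A limit is only known by its universal property, and the cone to test it on
is a thread through the given point, seen as a family of arrows from a
one-point space. *)
Lemma inverse_limit_surjective (A : cmn R) (p : forall s, cmn_hom A (X s)) :
  surjective_system S -> is_inverse_limit S p -> forall s, surjective (p s).
Proof.
move=> S_surjective [_ univ] s y _.
have [x xS <-] := thread_through S_surjective y.
have [P [a Pa]] := point_exists R.
have const_nonexpansive r : nonexpansive (fun _ : P => x r).
  by move=> b c; rewrite mdistxx mdist_ge0.
pose xi r : cmn_hom P (X r) := CmnHom (@const_nonexpansive r).
have xiS : is_cone S xi by apply: thread_cone => b r t rt; exact: xS.
have [nu [nuE _]] := univ P xi xiS.
exists (nu a) => //.
by rewrite (cmn_comp_apply (nuE s)).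
Qed.

(** * The inverse limit as the space of threads with the supremum distance *)

Section ThreadSpace.
Variables (Z : cmn R) (q : forall s, cmn_hom Z (X s)).
Hypothesis q_surjective : forall s, surjective (q s).

Lemma components_bounded :
  exists M : R, forall s (x y : X s), mdist x y <= M.
Proof.
have [M ZM] := cmn_bounded Z; exists M => s x y.
have [z _ <-] := q_surjective (I : [set: X s] x).
have [z' _ <-] := q_surjective (I : [set: X s] y).
exact: le_trans (cmn_nonexpansive _ _ _) (ZM z z').
Qed.

Definition thread_type := {x : forall s, X s | thread x}.

Definition sup_dist (x y : thread_type) : R :=
  sup (range (fun s => mdist (sval x s) (sval y s))).

Lemma le_sup_dist x y s : mdist (sval x s) (sval y s) <= sup_dist x y.
Proof.
have [M XM] := components_bounded.
by apply: ub_le_sup; [exists M => _ [t _ <-]|exists s].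
Qed.

(** The hypothesis [0 <= c] is what remains of the bound when [Sigma] is empty,
the supremum of the empty set being [0]. *)
Lemma sup_dist_le x y c :
  0 <= c -> (forall s, mdist (sval x s) (sval y s) <= c) -> sup_dist x y <= c.
Proof.
move=> c0 xyc; rewrite /sup_dist; set E := (X in sup X).
have [->|/set0P E0] := eqVneq E set0; first by rewrite sup0.
by apply: ge_sup => // _ [s _ <-].
Qed.

Lemma sup_dist_ge0 x y : 0 <= sup_dist x y.
Proof.
have [[s _]|noS] := pselect (exists s : Sigma, True).
  exact: le_trans (mdist_ge0 _ _) (le_sup_dist x y s).
rewrite /sup_dist [X in sup X](_ : _ = set0) ?sup0//.
by rewrite -subset0 => r [s]; case: noS; exists s.
Qed.

Lemma thread_eq (x y : thread_type) : (forall s, sval x s = sval y s) -> x = y.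
Proof.
case: x y => [x xS] [y yS] /= xy.
have {}xy : x = y by exact: functional_extensionality_dep.
by rewrite xy in xS *; rewrite (Prop_irrelevance xS yS).
Qed.

Lemma sup_dist_is_distance : is_distance sup_dist.
Proof.
split=> [x|x y xy0|x y|y x z].
- apply/eqP; rewrite eq_le sup_dist_ge0 andbT sup_dist_le// => s.
  by rewrite mdistxx.
- apply: thread_eq => s; apply/mdist_positivity/eqP.
  by rewrite eq_le mdist_ge0 andbT -xy0 le_sup_dist.
- by congr sup; apply: eq_imagel => s _; rewrite metric_sym.
- apply: sup_dist_le => [|s]; first by rewrite addr_ge0 ?sup_dist_ge0.
  apply: le_trans (metric_triangle _ (sval y s) _) _.
  by rewrite lerD ?le_sup_dist.
Qed.

(** The space of threads is a non-expansive image of [Z], under the map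
sending [z] to the limit thread of the points [q t z]; when [Sigma] is empty
there is a single thread, while [Z] may be empty. *)
Lemma thread_space_compact : compact [set: distance_space sup_dist_is_distance].
Proof.
have [[s0 _]|noS] := pselect (exists s : Sigma, True); last first.
  apply: distance_space_compact => U UU.
  have [x _] := filter_ex (@filterT _ U _); exists x => e e0.
  apply: filterE => y; apply: le_lt_trans e0.
  by apply: sup_dist_le => // s; case: noS; exists s.
have [U [UU tailU]] := ultrafilter_directed s0 Sigma_directed.
have /choice[phi philim] (z : Z) :
    exists x : thread_type, thread_limit U (fun t => q t z) (sval x).
  have [x xS xlim] := thread_limit_exists UU tailU (fun t => q t z).
  by exists (exist _ x xS).
apply: (image_compact (phi := phi)) => [x|z z'].
  have /choice[zs qzs] t : exists z, q t z = sval x t.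
    by have [z _ zx] := q_surjective (I : [set: X t] (sval x t)); exists z.
  (* The thread [x] is its own limit thread, and its coordinate [q t (zs t)]
     is eventually close to [q t z]. *)
  have [z zlim] := ultralimit UU zs; exists z.
  apply: thread_eq => s; apply: (eq_eventually (F := U) _) => e e0.
  apply: filterE => _.
  apply: (thread_limit_le UU tailU (philim z)
    (thread_limit_self UU (svalP x))) => //.
  apply: filterS (zlim e e0) => t zt; rewrite -qzs.
  exact: le_trans (cmn_nonexpansive _ _ _) (ltW zt).
apply: sup_dist_le => [|s]; first exact: mdist_ge0.
apply: (thread_limit_le UU tailU (philim z) (philim z')).
by apply: filterE => t; exact: cmn_nonexpansive.
Qed.

Definition thread_space : cmn R := Cmn thread_space_compact.

Lemma thread_proj_nonexpansive s :
  nonexpansive (fun x : thread_space => sval (x : thread_type) s).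
Proof. by move=> x y; exact: le_sup_dist. Qed.

Definition thread_proj s : cmn_hom thread_space (X s) :=
  CmnHom (@thread_proj_nonexpansive s).

Lemma thread_space_is_inverse_limit : is_inverse_limit S thread_proj.
Proof.
split=> [|A xi xiS]; first by apply: thread_cone => x; exact: svalP.
pose nu a : thread_space := exist _ _ (cone_thread a xiS) : thread_type.
have nu1 : nonexpansive nu.
  move=> a b; apply: sup_dist_le => [|s]; first exact: mdist_ge0.
  exact: cmn_nonexpansive.
exists (CmnHom nu1); split=> [s|mu muE]; first exact: cmn_hom_eq.
apply: cmn_hom_eq => a; apply: thread_eq => s /=.
by rewrite -(muE s).
Qed.

End ThreadSpace.

Lemma inverse_limit_exists (Z : cmn R) (q : forall s, cmn_hom Z (X s)) :
  (forall s, surjective (q s)) ->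
  exists (A : cmn R) (p : forall s, cmn_hom A (X s)), is_inverse_limit S p.
Proof.
move=> q_surjective; exists (thread_space q_surjective).
by exists (thread_proj q_surjective); exact: thread_space_is_inverse_limit.
Qed.

(** The distance of any inverse limit is the supremum of the distances of the
coordinates: this holds in the space of threads, from which there is a
non-expansive retraction onto the given limit, by uniqueness of the
factorization of [p] through itself. *)
Lemma inverse_limit_dist_le (A : cmn R) (p : forall s, cmn_hom A (X s)) :
  surjective_system S -> is_inverse_limit S p ->
  forall (a b : A) c, 0 <= c -> (forall s, mdist (p s a) (p s b) <= c) ->
    mdist a b <= c.
Proof.
move=> S_surjective pS a b c c0 abc.
have p_surjective := inverse_limit_surjective S_surjective pS.
have [pcone puniv] := pS.
have [Lcone Luniv] := thread_space_is_inverse_limit p_surjective.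
have [mu [muE _]] := Luniv _ _ pcone.
have [nu [nuE _]] := puniv _ _ Lcone.
have [id' [_ id_unique]] := puniv _ _ pcone.
have nu_mu : cmn_comp nu mu = cmn_id A.
  rewrite -(id_unique (cmn_id A)) => [|s]; last exact: cmn_hom_eq.
  apply/esym/id_unique => s; apply: cmn_hom_eq => x /=.
  by rewrite (cmn_comp_apply (nuE s)) (cmn_comp_apply (muE s)).
rewrite -[a](cmn_comp_apply nu_mu) -[b](cmn_comp_apply nu_mu).
apply: le_trans (cmn_nonexpansive _ _ _) _; apply: sup_dist_le => // s.
by move: (abc s); rewrite -!(cmn_comp_apply (muE s)).
Qed.

End Threads.

(** * Comparing systems with the same objects *)

(** The map is the limit along [U] of choices of [b] with [q t b = p t a]. For
[s <= t] two such choices are at least as far apart as the images of the two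
points in [X s], because [q t] and the bond are non-expansive. *)
Lemma inverse_limit_expansive (R : realType) (d : Order.disp_t)
    (Sigma : preorderType d) (Sigma_directed : upward_directed Sigma)
    (X : Sigma -> cmn R) (S S' : inverse_system X)
    (A B : cmn R) (p : forall s, cmn_hom A (X s))
    (q : forall s, cmn_hom B (X s)) :
  surjective_system S -> surjective_system S' ->
  is_inverse_limit S p -> is_inverse_limit S' q ->
  exists f : A -> B, expansive f.
Proof.
move=> S_surjective S'_surjective pS qS'.
have A_le := inverse_limit_dist_le Sigma_directed S_surjective pS.
have q_surjective := inverse_limit_surjective Sigma_directed S'_surjective qS'.
have [[s0 _]|noS] := pselect (exists s : Sigma, True); last first.
  have noSF (s : Sigma) : False by case: noS; exists s.
  have [nu _] := qS'.2 A (fun s => False_rect _ (noSF s))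
    (fun s => False_ind _ (noSF s)).
  exists nu => a b; apply: A_le => [|s]; first exact: mdist_ge0.
  by case: (noSF s).
have [U [UU tailU]] := ultrafilter_directed s0 Sigma_directed.
have /choice[g gE] (ta : Sigma * A) : exists b : B, q ta.1 b = p ta.1 ta.2.
  by have [b _ ba] := q_surjective ta.1 (p ta.1 ta.2) I; exists b.
have /choice[f flim] a := ultralimit UU (fun t => g (t, a)).
exists f => a b; apply: A_le => [|s]; first exact: mdist_ge0.
apply: (ge_eventually (F := U) _) => e e0.
have e20 : 0 < e / 2 by rewrite divr_gt0.
near=> t; have st : (s <= t)%O by near: t; exact: tailU.
have ft x : x = a \/ x = b -> mdist (f x) (g (t, x)) < e / 2.
  by case=> ->; near: t; exact: flim.
have [pS_cone _] := pS.
rewrite -!(cmn_comp_apply (pS_cone s t st)).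
apply: le_trans (cmn_nonexpansive _ _ _) _.
rewrite -(gE (t, a)) -(gE (t, b)).
apply: le_trans (cmn_nonexpansive _ _ _) _.
apply: le_trans (metric_triangle _ (f a) _) _.
rewrite [e]splitr addrCA lerD//.
  by rewrite metric_sym ltW// ft//; left.
apply: le_trans (metric_triangle _ (f b) _) _.
by rewrite lerD2l ltW// ft//; right.
Unshelve. all: by end_near. Qed.

Theorem lemma2p7 (R : realType) (d : Order.disp_t) (Sigma : preorderType d)
    (Sigma_directed : upward_directed Sigma)
    (X : Sigma -> cmn R) (S : inverse_system X)
    (S_surjective : surjective_system S) :
  ((exists (A : cmn R) (p : forall s, cmn_hom A (X s)), is_inverse_limit S p)
   <->
   (exists (Z : cmn R) (q : forall s, cmn_hom Z (X s)),
      forall s, surjective (q s)))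
  /\
  (forall (A : cmn R) (p : forall s, cmn_hom A (X s)), is_inverse_limit S p ->
    (forall S' : inverse_system X, surjective_system S' ->
       (exists (B : cmn R) (q : forall s, cmn_hom B (X s)),
          is_inverse_limit S' q)
       /\
       (forall (B : cmn R) (q : forall s, cmn_hom B (X s)),
          is_inverse_limit S' q -> isometric A B))
    /\
    (forall s, surjective (p s))).
Proof.
split; first split.
- move=> [A [p pS]]; exists A, p.
  exact (inverse_limit_surjective Sigma_directed S_surjective pS).
- move=> [Z [q q_surjective]].
  exact (inverse_limit_exists S Sigma_directed q_surjective).
move=> A p pS.
have p_surjective := inverse_limit_surjective Sigma_directed S_surjective pS.
split=> //.
move=> S' S'_surjective; split.
  exact (inverse_limit_exists S' Sigma_directed p_surjective).
move=> B q qS'.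
have [f f1] := inverse_limit_expansive Sigma_directed
  S_surjective S'_surjective pS qS'.
have [g g1] := inverse_limit_expansive Sigma_directed
  S'_surjective S_surjective qS' pS.
exact: expansive_pair_isometric f1 g1.
Qed.
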